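(* There exist $\sigma_0>0$ and a function $\varepsilon:[0,\sigma_0]\to[0,\infty)$ with $\varepsilon(\sigma)\to0$ as $\sigma\to0$ such that $$\sup_{0\leq m\leq n}d\bigl(\mathcal{R}_{m,n}(\sigma),\mathcal{N}_{m,n}\bigr)\leq\varepsilon(\sigma)$$ for every $0\leq\sigma\leq\sigma_0$, the supremum being over all integer pairs $0\le m\le n$.
   Context: Let $r>0$ and let $T$ be the open equilateral triangle with vertices $(0,0)$, $(2\sqrt3\,r,0)$, $(\sqrt3\,r,3r)$. McCartin's parametrization (known): for integers $0\leq m\leq n$ and $\sigma\geq0$ there is a unique phase triple $(L,M,N)$ (depending on $m,n,\sigma$) with $L\in(-\pi/2,0]$, $M,N\in[0,\pi/2)$, equal to $(0,0,0)$ at $\sigma=0$, solving $$(2L-M-N-(m+n)\pi)\tan L=3r\sigma,\quad (2M-N-L+m\pi)\tan M=3r\sigma,\quad (2N-L-M+n\pi)\tan N=3r\sigma .$$ Set $\mu=m+\frac{2M-N-L}{\pi}$, $\nu=n+\frac{2N-L-M}{\pi}$, $\ell=-\mu-\nu$, and $\delta_1=L-M-N$, $\delta_2=-L+M-N$, $\delta_3=-L-M+N$. The Robin modes are $$\begin{aligned}T_{m,n,\sigma}^{s/a}(x,y)={}&\cos\!\Bigl(\tfrac{\pi\ell}{3r}(3r-y)-\delta_1\Bigr)\,\mathrm{cs}\!\Bigl(\tfrac{\sqrt3\pi(\mu-\nu)}{9r}(x-\sqrt3r)\Bigr)\\&+\cos\!\Bigl(\tfrac{\pi\mu}{3r}(3r-y)-\delta_2\Bigr)\,\mathrm{cs}\!\Bigl(\tfrac{\sqrt3\pi(\nu-\ell)}{9r}(x-\sqrt3r)\Bigr)\\&+\cos\!\Bigl(\tfrac{\pi\nu}{3r}(3r-y)-\delta_3\Bigr)\,\mathrm{cs}\!\Bigl(\tfrac{\sqrt3\pi(\ell-\mu)}{9r}(x-\sqrt3r)\Bigr),\end{aligned}$$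 where $\mathrm{cs}=\cos$ for the symmetric mode $T^s$ and $\mathrm{cs}=\sin$ for the antisymmetric mode $T^a$. They are eigenfunctions of the Laplacian on $T$ with Robin condition $\partial_\nu u+\sigma u=0$ (outward normal derivative), and $T^a_{m,m,\sigma}\equiv0$. The modal space is $\mathcal{R}_{m,n}(\sigma)=\operatorname{span}\{T_{m,n,\sigma}^s,T_{m,n,\sigma}^a\}\subset L^2(T)$ (equal to $\operatorname{span}\{T^s_{m,m,\sigma}\}$ if $m=n$), and $\mathcal{N}_{m,n}=\mathcal{R}_{m,n}(0)$ is its Neumann limit. For closed subspaces $E,F\subset L^2(T)$, $$d(E,F)=\max\Bigl\{\sup_{u\in E,\ \|u\|_2=1}\operatorname{dist}(u,F),\ \sup_{v\in F,\ \|v\|_2=1}\operatorname{dist}(v,E)\Bigr\}.$$ *)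

(* Defs.v *)
From HB Require Import structures.
From mathcomp Require Import all_boot all_order all_algebra.
From mathcomp Require Import all_classical all_reals all_analysis.
From mathcomp Require Import measurable_realfun ring lra.
Import Order.TTheory GRing.Theory Num.Theory.
Import numFieldNormedType.Exports.

Set Implicit Arguments.
Unset Strict Implicit.
Unset Printing Implicit Defensive.

Local Open Scope classical_set_scope.
Local Open Scope ring_scope.

Definition open_triangle (R : realType) (A B C : R * R) : set (R * R) :=
  [set z | exists a b c : R,
     [/\ 0 < a, 0 < b, 0 < c, a + b + c = 1 &
         z = (a * A.1 + b * B.1 + c * C.1, a * A.2 + b * B.2 + c * C.2)]].

Definition triT (R : realType) (r : R) : set (R * R) :=
  open_triangle (0, 0) (2 * Num.sqrt 3 * r, 0) (Num.sqrt 3 * r, 3 * r).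

Section phases.
Context {R : realType}.
Variable r : R.

Definition is_phase_triple (m n : nat) (s : R) (p : R * R * R) : Prop :=
  let: (L, M, N) := p in
  [/\ [/\ - (pi / 2) < L <= 0, 0 <= M < pi / 2 & 0 <= N < pi / 2],
      s = 0 -> p = (0, 0, 0),
      (2 * L - M - N - (m + n)%:R * pi) * tan L = 3 * r * s,
      (2 * M - N - L + m%:R * pi) * tan M = 3 * r * s &
      (2 * N - L - M + n%:R * pi) * tan N = 3 * r * s].

(* The default value of xget is never reached when 0 < r and 0 <= s: see
   [phase_triple_exists_unique]. *)
Definition phase_triple (m n : nat) (s : R) : R * R * R :=
  xget (0, 0, 0) [set p | is_phase_triple m n s p].

End phases.

Section modes.
Context {R : realType}.
Variable r : R.

Definition mode (cs : R -> R) (m n : nat) (s : R) (z : R * R) : R :=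
  let: (L, M, N) := phase_triple r m n s in
  let mu := m%:R + (2 * M - N - L) / pi in
  let nu := n%:R + (2 * N - L - M) / pi in
  let ell := - mu - nu in
  let d1 := L - M - N in
  let d2 := - L + M - N in
  let d3 := - L - M + N in
  let: (x, y) := z in
    cos (pi * ell / (3 * r) * (3 * r - y) - d1)
      * cs (Num.sqrt 3 * pi * (mu - nu) / (9 * r) * (x - Num.sqrt 3 * r))
  + cos (pi * mu / (3 * r) * (3 * r - y) - d2)
      * cs (Num.sqrt 3 * pi * (nu - ell) / (9 * r) * (x - Num.sqrt 3 * r))
  + cos (pi * nu / (3 * r) * (3 * r - y) - d3)
      * cs (Num.sqrt 3 * pi * (ell - mu) / (9 * r) * (x - Num.sqrt 3 * r)).

Definition mode_s := mode cos.
Definition mode_a := mode sin.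

(* For m = n the antisymmetric mode vanishes identically, see [mode_a_diag],
   so this is then the span of the symmetric mode. *)
Definition modal_space (m n : nat) (s : R) : set (R * R -> R) :=
  [set u | exists a b : R,
     u = fun z => a * mode_s m n s z + b * mode_a m n s z].

Definition neumann_space (m n : nat) : set (R * R -> R) := modal_space m n 0.

End modes.

Section L2.
Context {R : realType}.
Variable D : set (R * R).

Definition leb2 : {measure set (measurableTypeR R * measurableTypeR R) -> \bar R} :=
  (lebesgue_measure \x lebesgue_measure)%E.

(* Elements of L^2(D) are represented by functions on the plane; only their
   values on D matter. *)
Definition l2norm (u : R * R -> R) : \bar R := 'N[leb2]_2%:E[(EFin \o u) \_ D].

Definition l2dist (u : R * R -> R) (F : set (R * R -> R)) : \bar R :=
  ereal_inf [set l2norm (u \- v) | v in F].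

(* The suprema are -oo when a space has no unit vector; modal spaces are
   nonzero, so this convention plays no role for them. *)
Definition gap (E F : set (R * R -> R)) : \bar R :=
  maxe (ereal_sup [set l2dist u F | u in [set u | E u /\ l2norm u = 1%E]])
       (ereal_sup [set l2dist v E | v in [set v | F v /\ l2norm v = 1%E]]).

End L2.

Lemma triTE (R : realType) (r : R) : 0 < r ->
  triT r = [set z | [/\ 0 < z.2, z.2 < Num.sqrt 3 * z.1
                      & z.2 + Num.sqrt 3 * z.1 < 6 * r]].
Proof.
move=> r0; rewrite /triT.
have: 0 < Num.sqrt 3 :> R by rewrite sqrtr_gt0.
have: Num.sqrt 3 * Num.sqrt 3 = 3 :> R by rewrite -expr2 sqr_sqrtr.
move: (Num.sqrt 3) => s s2 s0.
apply/seteqP; split => -[x y] /=.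
  move=> [a [b [c [a0 b0 c0 abc [-> ->]]]]] /=.
  have ra : 0 < a * r by rewrite mulr_gt0.
  have rb : 0 < b * r by rewrite mulr_gt0.
  have rc : 0 < c * r by rewrite mulr_gt0.
  have e : s * (a * 0 + b * (2 * s * r) + c * (s * r)) =
      (s * s) * (2 * (b * r) + c * r) by ring.
  have a1 : a * r + b * r + c * r = r by rewrite -!mulrDl abc mul1r.
  rewrite e s2; split; lra.
move=> [y0 yx xy].
exists (1 - (s * x - y) / (6 * r) - y / (3 * r)), ((s * x - y) / (6 * r)),
  (y / (3 * r)).
have r6 : 0 < 6 * r by lra.
have r3 : 0 < 3 * r by lra.
have rn : r != 0 by rewrite gt_eqF.
split.
- have -> : 1 - (s * x - y) / (6 * r) - y / (3 * r) =
    (6 * r - (y + s * x)) / (6 * r) by field.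
  by rewrite divr_gt0// subr_gt0.
- by rewrite divr_gt0// subr_gt0.
- by rewrite divr_gt0.
- by ring.
- have e1 : (1 - (s * x - y) / (6 * r) - y / (3 * r)) * 0 +
    (s * x - y) / (6 * r) * (2 * s * r) + y / (3 * r) * (s * r) =
    (s * s) * x / 3 by field.
  have e2 : y / (3 * r) * (3 * r) = y by rewrite divfK// gt_eqF.
  rewrite e1 s2 e2 !mulr0 !add0r; congr (_, _).
  by rewrite mulrAC divff// mul1r.
Qed.

Lemma measurable_triT (R : realType) (r : R) : 0 < r ->
  measurable (triT r : set (measurableTypeR R * measurableTypeR R)).
Proof.
move=> r0; rewrite triTE//.
pose T2 := (measurableTypeR R * measurableTypeR R)%type.
have m1 : measurable_fun [set: T2] (fun z => Num.sqrt 3 * z.1).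
  by apply: measurable_funM => //; exact: measurable_fst.
have m2 : measurable_fun [set: T2] (fun z => z.2) by exact: measurable_snd.
have H (f g : T2 -> R) : measurable_fun setT f -> measurable_fun setT g ->
    measurable [set z | f z < g z].
  move=> mf mg; have := measurable_fun_ltr mf mg.
  move=> /(_ measurableT [set true] I); rewrite setTI.
  by congr (measurable _); apply/seteqP; split.
have -> : [set z : T2 | [/\ 0 < z.2, z.2 < Num.sqrt 3 * z.1
                      & z.2 + Num.sqrt 3 * z.1 < 6 * r]] =
  [set z : T2 | 0 < z.2] `&` [set z : T2 | z.2 < Num.sqrt 3 * z.1] `&`
  [set z : T2 | z.2 + Num.sqrt 3 * z.1 < 6 * r].
  by apply/seteqP; split => z /=; [case|case=> -[]].
apply: measurableI; [apply: measurableI|]; apply: H => //.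
exact: measurable_funD.
Qed.

Lemma l2normE (R : realType) (D : set (R * R)) (u : R * R -> R) :
  l2norm D u = ((\int[leb2]_(z in D) ((u z) ^+ 2)%:E) `^ 2^-1)%E.
Proof.
rewrite /l2norm unlock /= [in RHS]integral_mkcond; congr ((_ `^ _)%E).
apply: eq_integral => z _; rewrite !patchE; case: ifPn => _ /=.
  by rewrite powR_mulrn// real_normK ?num_real.
by rewrite normr0 powR0.
Qed.

Section phase_facts.
Context {R : realType}.

Let mono (c x y g h : R) : 0 < c -> 0 <= x < pi / 2 -> 0 <= y < pi / 2 ->
  g * tan x = c -> h * tan y = c ->
  (g - h) * (x - y) <= 0 /\ ((g - h) * (x - y) = 0 -> x = y).
Proof.
wlog xy : x y g h / x <= y.
  move=> W c0 hx hy gx hyc; have [xy|/ltW xy] := lerP x y; first exact: W.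
  have [h1 h2] := W _ _ _ _ xy c0 hy hx hyc gx.
  have e : (g - h) * (x - y) = (h - g) * (y - x) by ring.
  by rewrite e; split=> // /h2.
move=> c0 /andP[x0 x1] /andP[y0 y1] gx hy.
move: xy; rewrite le_eqVlt => /orP[/eqP ->|xy].
  by rewrite subrr mulr0; split.
have p0 : 0 < pi / 2 :> R by rewrite divr_gt0 ?pi_gt0.
have inI (t : R) : 0 <= t -> t < pi / 2 -> t \in `](- (pi / 2)), (pi / 2)[.
  move=> t0 t1; rewrite in_itv /= t1 andbT; apply: lt_le_trans t0.
  by rewrite oppr_lt0.
have txy : tan x < tan y by rewrite ltr_tan// inI.
have tx : 0 < tan x.
  have: 0 <= tan x.
    have [->|xn0] := eqVneq x 0; first by rewrite tan0.
    have xp : 0 < x by rewrite lt_def xn0.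
    by rewrite -(@tan0 R) ltW// ltr_tan// inI.
  rewrite le_eqVlt => /orP[/eqP tx|//].
  by move: gx; rewrite -tx mulr0 => c00; move: c0; rewrite -c00 ltxx.
have ty : 0 < tan y := lt_trans tx txy.
have g0 : 0 < g by rewrite -(pmulr_lgt0 _ tx) gx.
have h0 : 0 < h by rewrite -(pmulr_lgt0 _ ty) hy.
have hg : h < g.
  rewrite ltNge; apply/negP => gh.
  have : g * tan x < h * tan y.
    apply: (@lt_le_trans _ _ (g * tan y)); first by rewrite ltr_pM2l.
    by rewrite ler_pM2r.
  by rewrite gx hy ltxx.
have : (g - h) * (x - y) < 0 by rewrite pmulr_rlt0 ?subr_lt0 ?subr_gt0.
by move=> k; split; [exact: ltW|move=> k0; move: k; rewrite k0 ltxx].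
Qed.

Let crit (c b0 b1 x : R) : 0 < c -> 0 < x < pi ->
  (forall t, 0 < t < pi ->
     expR (- (b0 + b1 * t + t * t) / c) * sin t <=
     expR (- (b0 + b1 * x + x * x) / c) * sin x) ->
  (b1 + 2 * x) * sin x = c * cos x.
Proof.
move=> c0 xpi xmax.
pose q (t : R) := - (b0 + b1 * t + t * t) / c.
pose f (t : R) := expR (q t) * sin t.
have df (t : R) : is_derive t 1 f
    (expR (q t) * cos t + (- (b1 + 2 * t) / c * expR (q t)) * sin t).
  have dq : is_derive t 1 q (- (b1 + 2 * t) / c).
    rewrite /q; apply: is_derive_eq; rewrite /GRing.scale /=; ring.
  rewrite /f; apply: is_derive_eq; rewrite /GRing.scale /=; ring.
have := @derive1_at_max R f 0 pi x (pi_ge0 _).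
case; [by move=> t _; exact: ex_derive|by rewrite in_itv|
  by move=> t; rewrite in_itv; exact: xmax|].
move=> _ d0; have dx := df x.
have : 'D_1 f x = 0 by [].
rewrite derive_val => e.
have en : expR (q x) != 0 by rewrite gt_eqF// expR_gt0.
have cn : c != 0 by rewrite gt_eqF.
have : expR (q x) * (c * cos x - (b1 + 2 * x) * sin x) = 0.
  rewrite -[RHS](mulr0 c) -e; field.
  done.
move/eqP; rewrite mulf_eq0 (negbTE en) /= subr_eq0 => /eqP ->.
by [].
Qed.

Lemma phase_triple_unique (r : R) (m n : nat) (s : R) (p p' : R * R * R) :
  0 < r -> 0 <= s -> is_phase_triple r m n s p -> is_phase_triple r m n s p' ->
  p = p'.
Proof.
move=> r0; rewrite le_eqVlt => /orP[/eqP <-|s0].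
  case: p p' => [[L M] N] [[L' M'] N'] [_ h _ _ _] [_ h' _ _ _].
  by rewrite h// h'.
case: p p' => [[L M] N] [[L' M'] N'].
move=> [[/andP[L0 L1] hM hN] _ eL eM eN] [[/andP[L0' L1'] hM' hN'] _ eL' eM' eN'].
have c0 : 0 < 3 * r * s by rewrite !mulr_gt0.
have hL : 0 <= - L < pi / 2 by rewrite oppr_ge0 L1 /= ltrNl.
have hL' : 0 <= - L' < pi / 2 by rewrite oppr_ge0 L1' /= ltrNl.
have eLn : (- (2 * L - M - N - (m + n)%:R * pi)) * tan (- L) = 3 * r * s.
  by rewrite tanN mulrNN.
have eLn' : (- (2 * L' - M' - N' - (m + n)%:R * pi)) * tan (- L') = 3 * r * s.
  by rewrite tanN mulrNN.
have [a1 a2] := mono c0 hL hL' eLn eLn'.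
have [b1 b2] := mono c0 hM hM' eM eM'.
have [d1 d2] := mono c0 hN hN' eN eN'.
set X := (_ * _) in a1 a2; set Y := (_ * _) in b1 b2; set Z := (_ * _) in d1 d2.
have e : X + Y + Z = ((- L + L') + (M - M')) ^+ 2 + ((- L + L') + (N - N')) ^+ 2 +
   ((M - M') - (N - N')) ^+ 2 by rewrite /X /Y /Z; ring.
have : 0 <= X + Y + Z by rewrite e !addr_ge0// sqr_ge0.
move=> S; have X0 : X = 0 by lra.
have Y0 : Y = 0 by lra.
have Z0 : Z = 0 by lra.
by rewrite -(opprK L) (a2 X0) opprK (b2 Y0) (d2 Z0).
Qed.

Let phase_energy (m n : nat) (c a M N : R) : R :=
  expR (- (a * a + M * M + N * N + a * M + a * N - M * N +
    (m + n)%:R * pi * a + m%:R * pi * M + n%:R * pi * N) / c)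
  * (sin a * sin M * sin N).

Let continuous_phase_energy (m n : nat) (c : R) :
  continuous (fun z : R * R * R => phase_energy m n c z.1.1 z.1.2 z.2).
Proof.
move=> z.
have c1 : z.1.1 @[z --> nbhs z] --> z.1.1.
  by apply: cvg_comp; [exact: cvg_fst|exact: cvg_fst].
have c2 : z.1.2 @[z --> nbhs z] --> z.1.2.
  by apply: cvg_comp; [exact: cvg_fst|exact: cvg_snd].
have c3 : z.2 @[z --> nbhs z] --> z.2 by exact: cvg_snd.
have cs (f : R * R * R -> R) : f z @[z --> nbhs z] --> f z ->
    sin (f z) @[z --> nbhs z] --> sin (f z).
  by move=> cf; apply: continuous_cvg => //; exact: continuous_sin.
rewrite /phase_energy; apply: cvgM; last first.
  by apply: cvgM; [apply: cvgM; exact: cs|exact: cs].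
apply: continuous_cvg; first exact: continuous_expR.
apply: cvgM; last exact: cvg_cst.
apply: cvgN.
repeat (first [exact: c1 | exact: c2 | exact: c3 | exact: cvg_cst |
  apply: cvgD | apply: cvgN | apply: cvgM]).
Qed.

Lemma phase_triple_exists (r : R) (m n : nat) (s : R) : 0 < r -> 0 <= s ->
  exists p, is_phase_triple r m n s p.
Proof.
move=> r0; rewrite le_eqVlt => /orP[/eqP <-|s0].
  have p0 : 0 < pi / 2 :> R by rewrite divr_gt0 ?pi_gt0.
  exists (0, 0, 0); split => //; last 3 first.
  - by rewrite tan0 !mulr0.
  - by rewrite tan0 !mulr0.
  - by rewrite tan0 !mulr0.
  by rewrite oppr_lt0 lexx p0.
have : 0 < 3 * r * s by rewrite !mulr_gt0.
rewrite /is_phase_triple; move: (3 * r * s) => c c0.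
have p0 : 0 < pi :> R := pi_gt0 _.
have p2 : 0 < pi / 2 :> R by lra.
pose I := `[0, pi]%classic : set R; pose A := I `*` I `*` I.
have A0 : A !=set0.
  by exists (0, 0, 0); rewrite /A /I /=; split => //=; rewrite ?in_itv/= ?lexx ltW.
have cA : compact A.
  by apply: compact_setX; [apply: compact_setX|]; exact: segment_compact.
have [[[a M] N] zA zmax] := compact_EVT_max A0 cA
  (continuous_subspaceT (@continuous_phase_energy m n c)).
move: zA; rewrite inE /A /I /= !in_itv /= => -[[/andP[a0 a1] /andP[M0 M1]] /andP[N0 N1]].
have {}zmax a' M' N' : 0 < a' < pi -> 0 < M' < pi -> 0 < N' < pi ->
    phase_energy m n c a' M' N' <= phase_energy m n c a M N.
  move=> /andP[? ?] /andP[? ?] /andP[? ?].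
  apply: (zmax (a', M', N')).
  by rewrite inE /A /I /=; split; first split; rewrite /= in_itv /= !ltW.
have E0 : 0 < phase_energy m n c a M N.
  have h : 0 < (pi / 2 : R) < pi by apply/andP; split=> //; lra.
  apply: lt_le_trans (zmax _ _ _ h h h).
  by rewrite /phase_energy sin_pihalf !mulr1 expR_gt0.
have bnd (x : R) : 0 <= x -> x <= pi -> sin x != 0 -> 0 < x < pi.
  move=> x0 x1 sx; rewrite !lt_def x0 x1 !andbT; apply/andP; split.
    by apply: contra sx => /eqP ->; rewrite sin0.
  by apply: contra sx => /eqP <-; rewrite sinpi.
have := E0; rewrite /phase_energy => /lt0r_neq0.
rewrite !mulf_eq0 !negb_or => /andP[_ /andP[/andP[/(bnd _ a0 a1) ha /(bnd _ M0 M1) hM]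
  /(bnd _ N0 N1) hN]].
have sa := sin_gt0_pi ha; have sM := sin_gt0_pi hM; have sN := sin_gt0_pi hN.
pose S : R := (m + n)%:R * pi; pose U : R := m%:R * pi; pose V : R := n%:R * pi.
have S0 : 0 <= S by rewrite mulr_ge0// ltW.
have U0 : 0 <= U by rewrite mulr_ge0// ltW.
have V0 : 0 <= V by rewrite mulr_ge0// ltW.
have ea : (M + N + S + 2 * a) * sin a = c * cos a.
  pose b0 : R := M * M + N * N - M * N + U * M + V * N.
  have E t : phase_energy m n c t M N =
      expR (- (b0 + (M + N + S) * t + t * t) / c) * sin t * (sin M * sin N).
    rewrite [RHS]mulrAC -[RHS]mulrA /phase_energy /b0 /S /U /V.
    by congr (expR (- _ / c) * _); ring.
  apply: (@crit _ b0) => // t ht; have := zmax _ _ _ ht hM hN.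
  by rewrite !E ler_pM2r// mulr_gt0.
have eM : (a - N + U + 2 * M) * sin M = c * cos M.
  pose b0 : R := a * a + N * N + a * N + S * a + V * N.
  have E t : phase_energy m n c a t N =
      expR (- (b0 + (a - N + U) * t + t * t) / c) * sin t * (sin a * sin N).
    rewrite [RHS]mulrAC -[RHS]mulrA /phase_energy /b0 /S /U /V.
    by congr (expR (- _ / c) * _); ring.
  apply: (@crit _ b0) => // t ht; have := zmax _ _ _ ha ht hN.
  by rewrite !E ler_pM2r// mulr_gt0.
have eN : (a - M + V + 2 * N) * sin N = c * cos N.
  pose b0 : R := a * a + M * M + a * M + S * a + U * M.
  have E t : phase_energy m n c a M t =
      expR (- (b0 + (a - M + V) * t + t * t) / c) * sin t * (sin a * sin M).
    rewrite [RHS]mulrAC -[RHS]mulrA /phase_energy /b0 /S /U /V.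
    by congr (expR (- _ / c) * _); ring.
  apply: (@crit _ b0) => // t ht; have := zmax _ _ _ ha hM ht.
  by rewrite !E ler_pM2r// mulr_gt0.
have cospos (g x : R) : 0 < x < pi -> g * sin x = c * cos x -> 0 < g ->
    0 < cos x /\ x < pi / 2.
  move=> hx e g0; have cx : 0 < cos x.
    by rewrite -(pmulr_rgt0 _ c0) -e mulr_gt0// sin_gt0_pi.
  split=> //; rewrite ltNge; apply/negP => xp; move: cx.
  have [x0 x1] := andP hx.
  rewrite ltNge => /negP; apply; rewrite -(@cos_pihalf R).
  move: xp; rewrite le_eqVlt => /orP[/eqP <-|xp]; first by rewrite lexx.
  by rewrite ltW// ltr_cos// in_itv /=; lra.
have ga : 0 < (M + N + S) + 2 * a.
  by move: ha hM hN => /andP[? _] /andP[? _] /andP[? _]; lra.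
have ge_pihalf (g x : R) : 0 < x < pi -> g * sin x = c * cos x -> g <= 0 ->
    pi / 2 <= x.
  move=> hx e g0; rewrite leNgt; apply/negP => xp.
  have : 0 < c * cos x.
    rewrite mulr_gt0// cos_gt0_pihalf// xp andbT.
    by move: hx => /andP[? _]; lra.
  by rewrite -e ltNge mulr_le0_ge0// ltW// sin_gt0_pi.
have gM : 0 < (a - N + U) + 2 * M.
  rewrite ltNge; apply/negP => g0; have := ge_pihalf _ _ hM eM g0.
  by move: ha hN => /andP[? _] /andP[_ ?] ?; lra.
have gN : 0 < (a - M + V) + 2 * N.
  rewrite ltNge; apply/negP => g0; have := ge_pihalf _ _ hN eN g0.
  by move: ha hM => /andP[? _] /andP[_ ?] ?; lra.
have [ca a2] := cospos _ _ ha ea ga.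
have [cM M2] := cospos _ _ hM eM gM.
have [cN N2] := cospos _ _ hN eN gN.
have tanE (g x : R) : g * sin x = c * cos x -> 0 < cos x -> g * tan x = c.
  by move=> e cx; rewrite /tan mulrA e mulfK// gt_eqF.
exists (- a, M, N); split.
- by rewrite oppr_le0 ltrN2 a0 a2 M0 M2 N0 N2.
- by move=> s_eq0; move: s0; rewrite s_eq0 ltxx.
- rewrite tanN mulrN -mulNr -[RHS](tanE _ _ ea ca) /S; congr (_ * _); ring.
- rewrite -[RHS](tanE _ _ eM cM) /U; congr (_ * _); ring.
- rewrite -[RHS](tanE _ _ eN cN) /V; congr (_ * _); ring.
Qed.

Lemma phase_triple_exists_unique (r : R) (m n : nat) (s : R) : 0 < r -> 0 <= s ->
  exists! p, is_phase_triple r m n s p.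
Proof.
move=> r0 s0; have [p hp] := phase_triple_exists m n r0 s0.
by exists p; split => // p'; exact: phase_triple_unique.
Qed.

Lemma phase_tripleP (r : R) (m n : nat) (s : R) : 0 < r -> 0 <= s ->
  is_phase_triple r m n s (phase_triple r m n s).
Proof. by move=> r0 s0; apply: xgetPex; exact: phase_triple_exists. Qed.

Lemma mode_a_diag (r : R) (m : nat) (s : R) (z : R * R) : 0 < r -> 0 <= s ->
  mode_a r m m s z = 0.
Proof.
move=> r0 s0; have := phase_tripleP m m r0 s0.
rewrite /mode_a /mode; move: (phase_triple r m m s) => [[L M] N] h.
have h' : is_phase_triple r m m s (L, N, M).
  case: h => -[hL hM hN] h0 eL eM eN; split => //.
  - by move=> /h0[-> -> ->].
  - by rewrite -eL; congr (_ * _); ring.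
  - by rewrite -eN; congr (_ * _); ring.
  - by rewrite -eM; congr (_ * _); ring.
have [MN _] := phase_triple_unique r0 s0 h h'.
case: z => x y; rewrite -MN (_ : 2 * M - L - M = 2 * M - M - L); last by ring.
set mu := _ + _ / pi; set ell := - mu - mu.
rewrite (_ : - L - M + M = - L + M - M); last by ring.
rewrite subrr mulr0 !mul0r sin0 mulr0 add0r -(opprB mu ell).
by rewrite mulrN !mulNr sinN mulrN addrN.
Qed.

End phase_facts.

(* Main.v *)
Require Import Defs.
From mathcomp Require Import all_boot all_order all_algebra.
From mathcomp Require Import all_classical all_reals all_analysis.
From mathcomp Require Import measurable_realfun ring lra zify.
Import Order.TTheory GRing.Theory Num.Theory.
Import numFieldNormedType.Exports.
Local Open Scope classical_set_scope.
Local Open Scope ring_scope.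

(** Put [e = sqrt (3 r sigma)]. The phase equations and [t <= tan t] bound all
    three phases by [e], whatever [m] and [n] are. The phases shift the wave
    numbers by [O(e)] only, and sine and cosine are 1-Lipschitz, so every mode
    is within [O(e)] of its Neumann limit, uniformly on the triangle and in
    [m, n]. What remains is a lower bound
      [||a T^s + b T^a||^2 >= K (a^2 + b^2)]
    for the Neumann modes with [K] independent of [m < n] (for [m = n], where
    [T^a = 0], one takes [b = 0]). It suffices to integrate over a thin
    rectangle around the altitude [x = sqrt 3 r]. On vertical segments the mode
    is a combination of the functions [cos (p pi (3r - y) / 3r)] with
    [p = m + n, m, n], orthogonal on [[0, 3r]] when distinct; the rectangle
    misses only a small part of that segment. For [m < n] the coefficient of
    [p = m] is [a cos (k (x - sqrt 3 r)) + b sin (k (x - sqrt 3 r))] with [k]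
    proportional to [m + 2n], and the mean of its square over an interval of
    fixed length centred at [sqrt 3 r] is at least a multiple of [a^2 + b^2].
    For [m = n] the coefficient of [p = 2m] is [a]. *)

(** * Elementary inequalities and the uniform bound on the phases *)

Section elementary.
Set Implicit Arguments.
Unset Strict Implicit.
Unset Printing Implicit Defensive.
Context {R : realType}.
Implicit Types (x y t k a b w : R).

Lemma is_derive_continuous (f df : R -> R) :
  (forall x, is_derive x 1 f (df x)) -> continuous f.
Proof.
by move=> fd x; apply: differentiable_continuous; apply/derivable1_diffP.
Qed.

Lemma derive1_lipschitz (f df : R -> R) x y :
  (forall t, is_derive t 1 f (df t)) -> (forall t, `|df t| <= 1) ->
  `|f x - f y| <= `|x - y|.
Proof.
move=> fd df1; wlog yx : x y / y <= x.
  move=> W; have [|/ltW] := leP y x; first exact: W.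
  by rewrite distrC (distrC x); exact: W.
have [c _ ->] := MVT_segment yx (fun t _ => fd t)
  (continuous_subspaceT (is_derive_continuous fd)).
by rewrite normrM ler_piMl.
Qed.

Lemma cos_lipschitz x y : `|cos x - cos y| <= `|x - y|.
Proof.
apply: (@derive1_lipschitz _ (fun t => - sin t)) => t.
by rewrite normrN; exact: sin_max.
Qed.

Lemma sin_lipschitz x y : `|sin x - sin y| <= `|x - y|.
Proof. by apply: (@derive1_lipschitz _ cos) => t; exact: cos_max. Qed.

(** Strictness makes the constant of [cos_sin_square_lower] positive. For [x <= 1] the mean value
    theorem gives [sin x = cos c * x] with [0 < c < 1], and [cos c = 1] would force [sin c = 0]. *)
Lemma sin_lt x : 0 < x -> sin x < x.
Proof.
move=> x0; have [x1|x1] := ltP 1 x.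
  by apply: le_lt_trans x1; exact: sin_le1.
have sd := @is_derive_sin R.
have cs : continuous (@sin R) by exact: continuous_sin.
have [c] := MVT x0 (fun t _ => sd t) (continuous_subspaceT cs).
rewrite in_itv /= => /andP[c0 cx]; rewrite sin0 !subr0 => ->.
rewrite gtr_pMl// lt_neqAle cos_le1 andbT; apply/eqP => c1.
have : 0 < sin c by apply: sin2_gt0; lra.
by have := cos2Dsin2 c; rewrite c1; nra.
Qed.

Lemma le_tan t : 0 <= t < pi / 2 -> t <= tan t.
Proof.
move=> /andP[t0 t2].
have ct x : 0 <= x <= t -> 0 < cos x.
  move=> /andP[x0 xt]; apply: cos_gt0_pihalf.
  rewrite (le_lt_trans xt t2) andbT; apply: lt_le_trans x0.
  by rewrite oppr_lt0 divr_gt0 ?pi_gt0.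
have hd x : x \in `]0, t[ -> is_derive x 1 (@tan R) ((cos x)^-2).
  rewrite in_itv /= => /andP[x0 xt]; apply: is_derive_tan.
  by rewrite gt_eqF// ct// !ltW.
have hc : {within `[0, t], continuous (@tan R)}.
  apply: continuous_in_subspaceT => x; rewrite inE /= in_itv /= => xt.
  by apply: continuous_tan; rewrite gt_eqF// ct.
have [c ch] := MVT_segment t0 hd hc.
rewrite tan0 !subr0 => ->; rewrite ler_peMl// invf_ge1.
  by rewrite expr_le1// ?cos_le1// ltW// ct.
by rewrite exprn_gt0// ct.
Qed.

Lemma sin_natpi (n : nat) : sin (n%:R * pi) = 0 :> R.
Proof.
elim: n => [|n IH]; first by rewrite mul0r sin0.
by rewrite -natr1 mulrDl mul1r sinDpi IH oppr0.
Qed.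

Lemma sin_intpi (n : int) : sin (n%:~R * pi) = 0 :> R.
Proof.
case: n => n; first exact: sin_natpi.
by rewrite NegzE mulrNz mulNr sinN sin_natpi oppr0.
Qed.

(** Each phase equation reads [g * tan x = e ^ 2]. Whenever [x <= g], it yields
    [x ^ 2 <= g * tan x = e ^ 2], since [x <= tan x]. The terms in [m] and [n] only increase [g]. *)
Lemma phase_bound (r : R) (m n : nat) (s : R) p : 0 < r -> 0 <= s ->
  is_phase_triple r m n s p ->
  let e := Num.sqrt (3 * r * s) in
  [/\ - e <= p.1.1 <= 0, 0 <= p.1.2 <= e & 0 <= p.2 <= e].
Proof.
move=> r0 s0; case: p => -[L M] N [[/andP[L0 L1] hM hN] _ eL eM eN] e /=.
have [M0 _] := andP hM; have [N0 _] := andP hN.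
have c0 : 0 <= 3 * r * s by rewrite !mulr_ge0// ltW.
have e0 : 0 <= e by exact: sqrtr_ge0.
have e2 : e ^+ 2 = 3 * r * s by rewrite sqr_sqrtr.
have key (g x : R) : 0 <= x < pi / 2 -> x <= g -> g * tan x = 3 * r * s -> x <= e.
  move=> hx xg gx; have [x0 _] := andP hx; have tx := le_tan hx.
  rewrite -(@ler_pXn2r _ 2)// ?nnegrE// e2 -gx expr2.
  by apply: ler_pM.
have p0 : 0 <= (pi : R) by exact: pi_ge0.
have mp (k : nat) : 0 <= k%:R * pi :> R by rewrite mulr_ge0.
have hL : 0 <= - L < pi / 2 by rewrite oppr_ge0 L1 /= ltrNl.
have eLn : (- (2 * L - M - N - (m + n)%:R * pi)) * tan (- L) = 3 * r * s.
  by rewrite tanN mulrNN.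
have Le : - L <= e.
  by apply: key eLn => //; have := mp (m + n)%N; lra.
(* The hypothesis [x <= g] is available for the larger of [M] and [N]; the smaller one is then
   bounded by the larger. *)
have [MN|NM] := leP M N.
  have Ne : N <= e by apply: key eN => //; have := mp n; lra.
  by split; apply/andP; split => //; lra.
have Me : M <= e by apply: key eM => //; have := mp m; lra.
by split; apply/andP; split => //; lra.
Qed.

End elementary.

(** * Lower bounds for integrals of squared trigonometric sums *)

Section integrals.
Set Implicit Arguments.
Unset Strict Implicit.
Unset Printing Implicit Defensive.
Context {R : realType}.
Implicit Types (x y t k a b w : R).

Lemma integral_is_derive (f F : R -> R) a b : a < b ->
  (forall x, is_derive x 1 F (f x)) -> continuous f ->
  (\int[lebesgue_measure]_(x in `[a, b]) (f x)%:E = (F b - F a)%:E)%E.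
Proof.
move=> ab Fd fc; have Fc := is_derive_continuous Fd.
rewrite (@continuous_FTC2 _ f F)//.
- exact: continuous_subspaceT.
- by split => [x _||]; [exact: ex_derive|exact/cvg_at_right_filter/Fc
    |exact/cvg_at_left_filter/Fc].
- by move=> x _; rewrite derive1E; apply: derive_val.
Qed.

(** The case [k = 0] occurs in [cos3_square_lower] for the constant function, through the frequency
    [k p + k p] with [p = 0]. *)
Definition cos_prim (A k y : R) : R :=
  if k == 0 then y else - sin (k * (A - y)) / k.

Lemma is_derive_cos_prim A k y : is_derive y 1 (cos_prim A k) (cos (k * (A - y))).
Proof.
rewrite /cos_prim; have [->|k0] := eqVneq k 0.
  by rewrite mul0r cos0; exact: is_derive_id.
apply: is_derive_eq; rewrite /GRing.scale /=.
by field.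
Qed.

Lemma cos_primB0 (A k : R) : k != 0 -> sin (k * A) = 0 ->
  cos_prim A k A - cos_prim A k 0 = 0.
Proof.
by move=> /negbTE k0 s0; rewrite /cos_prim k0 subrr mulr0 sin0 subr0 s0 subrr.
Qed.

Lemma cosM k1 k2 t :
  cos (k1 * t) * cos (k2 * t) = (cos ((k1 - k2) * t) + cos ((k1 + k2) * t)) / 2.
Proof. by rewrite mulrBl (mulrDl k1) cosB cosD; field. Qed.

(* [Phi] is a primitive of [f ^+ 2]: orthogonality on [[0, A]] gives
   [Phi A - Phi 0 >= A / 2 * Q], and the mean value theorem bounds the parts
   cut off at both ends. *)
Lemma cos3_square_lower (A c1 c2 c3 : R) (p1 p2 p3 : nat) (k : nat -> R) : 0 < A ->
  p1 != p2 -> p1 != p3 -> p2 != p3 -> (forall p, k p = p%:R * pi / A) ->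
  ((A / 4 * (c1 ^+ 2 + c2 ^+ 2 + c3 ^+ 2))%:E <=
   \int[lebesgue_measure]_(y in `[(A / 36)%R, (A - A / 18)%R])
     ((c1 * cos (k p1 * (A - y)) + c2 * cos (k p2 * (A - y)) +
       c3 * cos (k p3 * (A - y))) ^+ 2)%:E)%E.
Proof.
move=> A0 p12 p13 p23 kE; set Q := c1 ^+ 2 + _ + _.
have An0 : A != 0 by rewrite gt_eqF.
pose f y := c1 * cos (k p1 * (A - y)) + c2 * cos (k p2 * (A - y)) +
       c3 * cos (k p3 * (A - y)).
pose P := cos_prim A.
pose Phi y : R :=
  c1 ^+ 2 / 2 * (y + P (k p1 + k p1) y) + c2 ^+ 2 / 2 * (y + P (k p2 + k p2) y) +
  c3 ^+ 2 / 2 * (y + P (k p3 + k p3) y) +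
  (c1 * c2 * (P (k p1 - k p2) y + P (k p1 + k p2) y) +
   c1 * c3 * (P (k p1 - k p3) y + P (k p1 + k p3) y) +
   c2 * c3 * (P (k p2 - k p3) y + P (k p2 + k p3) y)).
have Pd q y := is_derive_cos_prim A q y.
have Phid y : is_derive y 1 Phi (f y ^+ 2).
  rewrite /Phi /P; apply: is_derive_eq; rewrite /GRing.scale /= /f.
  set t := A - y.
  have E1 p : cos ((k p + k p) * t) = 2 * (cos (k p * t) * cos (k p * t)) - 1.
    by rewrite cosM subrr mul0r cos0; field.
  have E2 p q : cos ((k p - k q) * t) =
      2 * (cos (k p * t) * cos (k q * t)) - cos ((k p + k q) * t).
    by rewrite cosM; field.
  by rewrite !E1 !E2; field.
have fc : continuous (fun y => f y ^+ 2).
  move=> y; apply/differentiable_continuous/derivable1_diffP.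
  by rewrite /f; exact: ex_derive.
have lt1 : A / 36 < A - A / 18 by lra.
rewrite (integral_is_derive lt1 Phid fc) lee_fin.
(* Cauchy-Schwarz for three terms, each cosine being at most 1 in absolute value. *)
have fQ y : f y ^+ 2 <= 3 * Q.
  rewrite /f /Q; set u1 := cos _; set u2 := cos _; set u3 := cos _.
  have h (u c : R) : `|u| <= 1 -> (c * u) ^+ 2 <= c ^+ 2.
    move=> u1'; rewrite exprMn ler_piMr ?sqr_ge0//.
    by rewrite -real_normK ?num_real// exprn_ile1.
  have := h u1 c1 (cos_max _); have := h u2 c2 (cos_max _).
  have := h u3 c3 (cos_max _).
  move: (c1 * u1) (c2 * u2) (c3 * u3) => v1 v2 v3 h1 h2 h3.
  apply: (@le_trans _ _ (3 * (v1 ^+ 2 + v2 ^+ 2 + v3 ^+ 2))); last by lra.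
  have := sqr_ge0 (v1 - v2); have := sqr_ge0 (v1 - v3); have := sqr_ge0 (v2 - v3).
  by rewrite !expr2; lra.
have Phic := is_derive_continuous Phid.
have tail a b : a <= b -> Phi b - Phi a <= 3 * Q * (b - a).
  move=> ab.
  have [c _ ->] := MVT_segment ab (fun t _ => Phid t) (continuous_subspaceT Phic).
  by rewrite ler_wpM2r ?subr_ge0.
(* The two missing pieces have total length [A / 36 + A / 18 = A / 12], so they cost at most
   [3 * Q * (A / 12) = A / 4 * Q], half of the bound over [[0, A]]. *)
have t1 := tail 0 (A / 36) ltac:(lra).
have t2 := tail (A - A / 18) A ltac:(lra).
have sk (z : int) : sin (z%:~R * pi / A * A) = 0 by rewrite divfK// sin_intpi.
have dk p q : k p - k q = (p%:Z - q%:Z)%:~R * pi / A.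
  by rewrite !kE intrB; field.
have sumk p q : k p + k q = (p%:Z + q%:Z)%:~R * pi / A.
  by rewrite !kE intrD; field.
have kn0 (z : int) : z != 0 -> z%:~R * pi / A != 0.
  move=> z0; rewrite !mulf_neq0 ?invr_eq0// ?intr_eq0//.
  by rewrite gt_eqF// pi_gt0.
have PB (z : int) : z != 0 -> P (z%:~R * pi / A) A - P (z%:~R * pi / A) 0 = 0.
  by move=> z0; apply: cos_primB0 => //; exact: kn0.
have Pge (z : int) : 0 <= P (z%:~R * pi / A) A - P (z%:~R * pi / A) 0.
  have [->|/PB->//] := eqVneq z 0.
  by rewrite /P /cos_prim !mul0r eqxx subr0 ltW.
(* Sums and differences of distinct naturals are nonzero, so all cross terms vanish by [PB]. A
   diagonal term survives only if its index is 0, and it is then nonnegative by [Pge]. *)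
have full : A / 2 * Q <= Phi A - Phi 0.
  have -> : Phi A - Phi 0 = A / 2 * Q +
   (c1 ^+ 2 / 2 * (P (k p1 + k p1) A - P (k p1 + k p1) 0) +
    c2 ^+ 2 / 2 * (P (k p2 + k p2) A - P (k p2 + k p2) 0) +
    c3 ^+ 2 / 2 * (P (k p3 + k p3) A - P (k p3 + k p3) 0)) +
   (c1 * c2 * ((P (k p1 - k p2) A - P (k p1 - k p2) 0) +
      (P (k p1 + k p2) A - P (k p1 + k p2) 0)) +
    c1 * c3 * ((P (k p1 - k p3) A - P (k p1 - k p3) 0) +
      (P (k p1 + k p3) A - P (k p1 + k p3) 0)) +
    c2 * c3 * ((P (k p2 - k p3) A - P (k p2 - k p3) 0) +
      (P (k p2 + k p3) A - P (k p2 + k p3) 0))).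
    by rewrite /Phi /Q; field.
  rewrite !dk !sumk !(PB (_ - _)) ?(PB (Posz p1 + Posz p2))
    ?(PB (Posz p1 + Posz p3)) ?(PB (Posz p2 + Posz p3)); try lia.
  rewrite !addr0 !mulr0 !addr0 lerDl.
  by rewrite !addr_ge0// mulr_ge0// divr_ge0// sqr_ge0.
have Q0 : 0 <= Q by rewrite !addr_ge0// sqr_ge0.
have := mulr_ge0 (ltW A0) Q0.
by lra.
Qed.

(** The interval is centred at [x0], so the cross term integrates to 0 and the integral is [a ^ 2 *
    (w + S / (2 * k)) + b ^ 2 * (w - S / (2 * k))] with [S = sin (2 * k * w)]. It remains to keep
    [|sin X| / X] away from 1 for all [X >= 2 * k0 * w]. *)
Lemma cos_sin_square_lower k0 w : 0 < k0 -> 0 < w ->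
  exists2 K : R, 0 < K & forall k x0 a b, k0 <= k ->
   ((K * (a ^+ 2 + b ^+ 2))%:E <=
   \int[lebesgue_measure]_(x in `[(x0 - w)%R, (x0 + w)%R])
     ((a * cos (k * (x - x0)) + b * sin (k * (x - x0))) ^+ 2)%:E)%E.
Proof.
move=> k00 w0; pose X0 := 2 * k0 * w.
have X00 : 0 < X0 by rewrite !mulr_gt0.
(* The first entry serves [X >= 2], where [|sin X| <= 1 <= X / 2]. The second serves [X0 <= X < 2]:
   as [X - sin X] is nondecreasing, it is at least [X0 - sin X0 >= 2 * q >= q * X]. *)
pose q := Num.min (1 / 2) ((X0 - sin X0) / 2).
have q0 : 0 < q by rewrite lt_min !divr_gt0// subr_gt0 sin_lt.
have sinX X : X0 <= X -> `|sin X| <= (1 - q) * X.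
  move=> X0X; have Xp : 0 < X := lt_le_trans X00 X0X.
  have [X2|X2] := leP 2 X.
    have : q <= 1 / 2 by rewrite ge_min lexx.
    by have := sin_max X; nra.
  have s0 : 0 < sin X by apply: sin2_gt0; rewrite Xp X2.
  rewrite gtr0_norm//.
  have : q <= (X0 - sin X0) / 2 by rewrite ge_min lexx orbT.
  have sl := sin_lipschitz X X0.
  have : sin X - sin X0 <= X - X0.
    apply: le_trans (ler_norm _) _; apply: le_trans sl _.
    by rewrite ger0_norm ?subr_ge0.
  move=> h1 h2.
  have : q * X <= q * 2 by rewrite ler_pM2l// ltW.
  lra.
exists (w * q); first by rewrite mulr_gt0.
move=> k x0 a b k0k.
have kp : 0 < k := lt_le_trans k00 k0k.
have kn : k != 0 by rewrite gt_eqF.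
pose F x := a ^+ 2 * ((x - x0) / 2 + sin (2 * k * (x - x0)) / (4 * k)) +
  b ^+ 2 * ((x - x0) / 2 - sin (2 * k * (x - x0)) / (4 * k)) -
  a * b * cos (2 * k * (x - x0)) / (2 * k).
have dF x : is_derive x 1 F
    ((a * cos (k * (x - x0)) + b * sin (k * (x - x0))) ^+ 2).
  rewrite /F; apply: is_derive_eq; rewrite /GRing.scale /=.
  have -> : 2 * k * (x - x0) = k * (x - x0) + k * (x - x0) by ring.
  rewrite cosD sinD; set c := cos _; set s := sin _.
  have e : c ^+ 2 + s ^+ 2 = 1 by exact: cos2Dsin2.
  (* Writing 1 as [c ^ 2 + s ^ 2] leaves a purely algebraic identity. *)
  transitivity (a ^+ 2 * ((c ^+ 2 + s ^+ 2) + (c * c - s * s)) / 2 +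
    b ^+ 2 * ((c ^+ 2 + s ^+ 2) - (c * c - s * s)) / 2 + a * b * (s * c + c * s)).
    by rewrite e; field.
  by field.
have fc : continuous (fun x =>
    (a * cos (k * (x - x0)) + b * sin (k * (x - x0))) ^+ 2).
  by move=> x; apply/differentiable_continuous/derivable1_diffP.
rewrite (integral_is_derive _ dF fc) ?lee_fin; last by lra.
rewrite /F.
have -> : x0 + w - x0 = w by ring.
have -> : x0 - w - x0 = - w by ring.
rewrite !mulrN sinN cosN.
set S := sin _; set C := cos _.
have SX : `|S| <= (1 - q) * (2 * k * w).
  by apply: sinX; rewrite /X0 ler_pM2r// ler_pM2l.
have : `|S / (2 * k)| <= (1 - q) * w.
  rewrite normrM normfV (gtr0_norm (_ : 0 < 2 * k)) ?mulr_gt0//.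
  rewrite ler_pdivrMr ?mulr_gt0//; apply: le_trans SX _.
  by rewrite le_eqVlt; apply/orP; left; apply/eqP; ring.
rewrite ler_norml => /andP[h1 h2].
have -> : a ^+ 2 * (w / 2 + S / (4 * k)) + b ^+ 2 * (w / 2 - S / (4 * k)) -
    a * b * C / (2 * k) -
    (a ^+ 2 * (- w / 2 + - S / (4 * k)) + b ^+ 2 * (- w / 2 - - S / (4 * k)) -
     a * b * C / (2 * k)) =
    a ^+ 2 * (w + S / (2 * k)) + b ^+ 2 * (w - S / (2 * k)) by field.
rewrite mulrDr !(mulrC (w * q)).
by apply: lerD; rewrite ler_wpM2l ?sqr_ge0//; lra.
Qed.

End integrals.

(** * Pointwise comparison of Robin and Neumann modes *)

Section modes_pointwise.
Set Implicit Arguments.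
Unset Strict Implicit.
Unset Printing Implicit Defensive.
Context {R : realType}.
Variable r : R.
Hypothesis r0 : 0 < r.
Implicit Types (x y a b s e : R).

Lemma sqrt3_sqr : Num.sqrt 3 * Num.sqrt 3 = 3 :> R.
Proof. by rewrite -expr2 sqr_sqrtr. Qed.

Lemma sqrt3_gt0 : 0 < Num.sqrt 3 :> R.
Proof. by rewrite sqrtr_gt0. Qed.

Lemma phase_triple0 m n : phase_triple r m n 0 = (0, 0, 0).
Proof.
have := phase_tripleP m n r0 (lexx 0).
by case: phase_triple => -[L M] N [_ h _ _ _]; exact: h.
Qed.

Lemma triT_bounds x y : triT r (x, y) ->
  `|3 * r - y| <= 3 * r /\ `|x - Num.sqrt 3 * r| <= Num.sqrt 3 * r.
Proof.
rewrite triTE//= => -[y0 yx xy].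
have := sqrt3_gt0; have := sqrt3_sqr; move: (Num.sqrt 3) yx xy => q yx xy q2 q0.
have x0 : 0 < x by rewrite -(pmulr_rgt0 _ q0); lra.
have x1 : x < 2 * q * r.
  rewrite -(ltr_pM2l q0) (_ : q * (2 * q * r) = 2 * (q * q) * r); last by ring.
  by rewrite q2; lra.
by rewrite !ler_norml; split; apply/andP; split; lra.
Qed.

Lemma mul_dist (u v u' v' : R) : `|v| <= 1 -> `|u'| <= 1 ->
  `|u * v - u' * v'| <= `|u - u'| + `|v - v'|.
Proof.
move=> v1 u1; have -> : u * v - u' * v' = (u - u') * v + u' * (v - v') by ring.
apply: le_trans (ler_normD _ _) _; rewrite !normrM.
by apply: lerD; [rewrite ler_piMr|rewrite ler_piMl].
Qed.

(* The wave numbers [mu], [nu], [ell] move by at most [6 e / pi] however large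
   they are, so the arguments of the trigonometric functions move by [O(e)]
   uniformly in the mode. *)
Lemma mode_term_dist (cs : R -> R) (p p' q q' d x y e : R) :
  (forall u v, `|cs u - cs v| <= `|u - v|) -> (forall u, `|cs u| <= 1) ->
  triT r (x, y) -> `|p - p'| <= 4 * e / pi -> `|q - q'| <= 6 * e / pi ->
  `|d| <= 3 * e ->
  `|cos (pi * p / (3 * r) * (3 * r - y) - d)
      * cs (Num.sqrt 3 * pi * q / (9 * r) * (x - Num.sqrt 3 * r)) -
    cos (pi * p' / (3 * r) * (3 * r - y) - 0)
      * cs (Num.sqrt 3 * pi * q' / (9 * r) * (x - Num.sqrt 3 * r))| <= 9 * e.
Proof.
move=> csl cs1 /triT_bounds[hy hx] hp hq hd.
have p0 := pi_gt0 R; have q0 := sqrt3_gt0.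
apply: le_trans (mul_dist _ _ (cs1 _) (cos_max _)) _.
have -> : 9 * e = (4 * e + 3 * e) + 2 * e by ring.
apply: lerD.
  apply: le_trans (cos_lipschitz _ _) _.
  set t := 3 * r - y.
  have -> : pi * p / (3 * r) * t - d - (pi * p' / (3 * r) * t - 0) =
    pi * (p - p') * (t / (3 * r)) - d by field; rewrite gt_eqF.
  apply: le_trans (ler_normB _ _) _; apply: lerD => //.
  have t1 : `|t / (3 * r)| <= 1.
    rewrite normrM normfV (gtr0_norm (_ : 0 < 3 * r)) ?mulr_gt0//.
    by rewrite ler_pdivrMr ?mulr_gt0// mul1r.
  rewrite normrM; apply: le_trans (ler_piMr _ t1) _ => //.
  by rewrite normrM gtr0_norm// mulrC -ler_pdivlMr.
apply: le_trans (csl _ _) _.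
set t := x - _.
have -> : Num.sqrt 3 * pi * q / (9 * r) * t - Num.sqrt 3 * pi * q' / (9 * r) * t =
    pi * (q - q') * ((Num.sqrt 3 * t) / (9 * r)) by field; rewrite gt_eqF.
have t1 : `|(Num.sqrt 3 * t) / (9 * r)| <= 1 / 3.
  rewrite normrM normfV (gtr0_norm (_ : 0 < 9 * r)) ?mulr_gt0//.
  rewrite ler_pdivrMr ?mulr_gt0// normrM gtr0_norm//.
  have : Num.sqrt 3 * `|t| <= Num.sqrt 3 * (Num.sqrt 3 * r) by rewrite ler_pM2l.
  by rewrite mulrA sqrt3_sqr; lra.
have -> : 2 * e = 6 * e * (1 / 3) by field.
rewrite normrM; apply: ler_pM => //.
by rewrite normrM gtr0_norm// mulrC -ler_pdivlMr.
Qed.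

(** Each of the three products moves by at most [9 * e]. Up to the factor [pi], a wave number shifts
    by a combination such as [2 * L - M - N] and a difference of two by one such as [3 * M - 3 * N];
    the integers [m] and [n] cancel. *)
Lemma mode_dist (cs : R -> R) m n s (z : R * R) :
  (forall u v, `|cs u - cs v| <= `|u - v|) -> (forall u, `|cs u| <= 1) ->
  0 <= s -> triT r z ->
  `|mode r cs m n s z - mode r cs m n 0 z| <= 27 * Num.sqrt (3 * r * s).
Proof.
move=> csl cs1 s0 Tz.
have := phase_bound r0 s0 (phase_tripleP m n r0 s0).
rewrite /mode phase_triple0; set e := Num.sqrt _.
move: (phase_triple r m n s) => -[[L M] N] /= [/andP[L0 L1] /andP[M0 M1] /andP[N0 N1]].
case: z Tz => x y Tz.
have e0 : 0 <= e by rewrite (le_trans M0).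
have ep (c' u v : R) : - c' * e <= u <= c' * e -> v = u / pi ->
    `|v| <= c' * e / pi.
  move=> hu ->; rewrite normrM normfV (gtr0_norm (pi_gt0 _)).
  by rewrite ler_pM2r ?invr_gt0 ?pi_gt0// ler_norml -mulNr.
set mu := m%:R + (2 * M - N - L) / pi.
set nu := n%:R + (2 * N - L - M) / pi.
set mu0 := m%:R + (2 * 0 - 0 - 0) / pi.
set nu0 := n%:R + (2 * 0 - 0 - 0) / pi.
have hd1 : `|L - M - N| <= 3 * e by rewrite ler_norml; apply/andP; split; lra.
have hd2 : `|- L + M - N| <= 3 * e by rewrite ler_norml; apply/andP; split; lra.
have hd3 : `|- L - M + N| <= 3 * e by rewrite ler_norml; apply/andP; split; lra.
have hp1 : `|- mu - nu - (- mu0 - nu0)| <= 4 * e / pi.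
  apply: (ep _ (2 * L - M - N)); last by rewrite /mu /nu /mu0 /nu0; ring.
  by apply/andP; split; lra.
have hp2 : `|mu - mu0| <= 4 * e / pi.
  apply: (ep _ (2 * M - N - L)); last by rewrite /mu /mu0; ring.
  by apply/andP; split; lra.
have hp3 : `|nu - nu0| <= 4 * e / pi.
  apply: (ep _ (2 * N - L - M)); last by rewrite /nu /nu0; ring.
  by apply/andP; split; lra.
have hq1 : `|mu - nu - (mu0 - nu0)| <= 6 * e / pi.
  apply: (ep _ (3 * M - 3 * N)); last by rewrite /mu /nu /mu0 /nu0; ring.
  by apply/andP; split; lra.
have hq2 : `|nu - (- mu - nu) - (nu0 - (- mu0 - nu0))| <= 6 * e / pi.
  apply: (ep _ (3 * N - 3 * L)); last by rewrite /mu /nu /mu0 /nu0; ring.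
  by apply/andP; split; lra.
have hq3 : `|- mu - nu - mu - (- mu0 - nu0 - mu0)| <= 6 * e / pi.
  apply: (ep _ (3 * L - 3 * M)); last by rewrite /mu /nu /mu0 /nu0; ring.
  by apply/andP; split; lra.
have h1 := mode_term_dist csl cs1 Tz hp1 hq1 hd1.
have h2 := mode_term_dist csl cs1 Tz hp2 hq2 hd2.
have h3 := mode_term_dist csl cs1 Tz hp3 hq3 hd3.
rewrite (_ : 0 - 0 - 0 = 0); last by ring.
rewrite (_ : - 0 + 0 - 0 = 0); last by ring.
rewrite (_ : - 0 - 0 + 0 = 0); last by ring.
move: h1 h2 h3.
set u1 := cos _ * cs _; set u1' := cos _ * cs _.
set u2 := cos _ * cs _; set u2' := cos _ * cs _.
set u3 := cos _ * cs _; set u3' := cos _ * cs _.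
move=> h1 h2 h3.
have -> : u1 + u2 + u3 - (u1' + u2' + u3') = (u1 - u1') + (u2 - u2') + (u3 - u3')
  by ring.
apply: le_trans (ler_normD _ _) _; have := ler_normD (u1 - u1') (u2 - u2').
by lra.
Qed.

(** For fixed [x] this is a cosine sum in [y] of the kind treated by [cos3_square_lower]. The
    Neumann value of [ell] is [- (m + n)], and evenness of the cosine removes its sign. *)
Lemma neumann_modeE m n a b x y :
  let c (q : R) := a * cos (Num.sqrt 3 * pi / (9 * r) * q * (x - Num.sqrt 3 * r)) +
    b * sin (Num.sqrt 3 * pi / (9 * r) * q * (x - Num.sqrt 3 * r)) in
  let k (p : nat) := p%:R * pi / (3 * r) in
  a * mode_s r m n 0 (x, y) + b * mode_a r m n 0 (x, y) =
  c (m%:R - n%:R) * cos (k (m + n)%N * (3 * r - y)) +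
  c (m%:R + 2 * n%:R) * cos (k m * (3 * r - y)) +
  c (- (2 * m%:R + n%:R)) * cos (k n * (3 * r - y)).
Proof.
move=> c k; rewrite /mode_s /mode_a /mode phase_triple0 /c /k.
rewrite !(mulr0, subr0, addr0, mul0r, oppr0).
set t := 3 * r - y; set u := x - _.
have rn : r != 0 by rewrite gt_eqF.
rewrite (_ : pi * (- m%:R - n%:R) / (3 * r) * t =
  - ((m + n)%:R * pi / (3 * r) * t)); last by rewrite natrD; field.
rewrite cosN !(mulrC pi).
rewrite (_ : Num.sqrt 3 * pi * (m%:R - n%:R) / (9 * r) * u =
  pi * Num.sqrt 3 / (9 * r) * (m%:R - n%:R) * u); last by field.
rewrite (_ : Num.sqrt 3 * pi * (n%:R - (- m%:R - n%:R)) / (9 * r) * u =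
  pi * Num.sqrt 3 / (9 * r) * (m%:R + 2 * n%:R) * u); last by field.
rewrite (_ : Num.sqrt 3 * pi * (- m%:R - n%:R - m%:R) / (9 * r) * u =
  pi * Num.sqrt 3 / (9 * r) * (- (2 * m%:R + n%:R)) * u); last by field.
by rewrite !(mulrC _ pi); ring.
Qed.

End modes_pointwise.

(** * Uniform lower bound for the norm of Neumann modes *)

Section lower_bound.
Set Implicit Arguments.
Unset Strict Implicit.
Unset Printing Implicit Defensive.
Context {R : realType}.
Notation T2 := (measurableTypeR R * measurableTypeR R)%type.
Implicit Types (x y a b s e : R).

(** By Tonelli, a bound on the vertical slices of a rectangle inside [D] suffices. Both integrands
    are extended by zero to the whole space for this. *)
Lemma le_integral_rect (f : T2 -> R) (g : measurableTypeR R -> R)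
    (I J : set (measurableTypeR R)) (D : set T2) :
  measurable I -> measurable J -> measurable D -> I `*` J `<=` D ->
  measurable_fun setT f -> measurable_fun setT g ->
  (forall z, 0 <= f z) -> (forall x, 0 <= g x) ->
  (forall x, I x -> ((g x)%:E <= \int[lebesgue_measure]_(y in J) (f (x, y))%:E)%E) ->
  (\int[lebesgue_measure]_(x in I) (g x)%:E <= \int[leb2]_(z in D) (f z)%:E)%E.
Proof.
move=> mI mJ mD IJD mf mg f0 g0 gf.
have mIJ : measurable (I `*` J) by exact: measurableX.
have mfE (A : set T2) : measurable_fun A (EFin \o f).
  by apply/measurable_EFinP; exact: measurable_funTS.
apply: (@le_trans _ _ (\int[leb2]_(z in I `*` J) (f z)%:E)%E); last first.
  apply: ge0_subset_integral => //.
  by move=> z _; rewrite lee_fin.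
rewrite integral_mkcond [leRHS]integral_mkcond.
have m1 : measurable_fun setT ((EFin \o f) \_ (I `*` J)).
  exact: (measurable_restrictT _ mIJ).1.
have p1 z : (0 <= ((EFin \o f) \_ (I `*` J)) z)%E.
  by apply: erestrict_ge0 => ? _ /=; rewrite lee_fin.
rewrite /leb2 fubini_tonelli1//; apply: ge0_le_integral => //.
- by move=> x _; apply: erestrict_ge0 => ? _ /=; rewrite lee_fin.
- have mgI : measurable_fun I (EFin \o g).
    by apply/measurable_EFinP; exact: measurable_funTS.
  exact: ((measurable_restrictT _ mI).1 mgI).
- exact: measurable_fun_fubini_tonelli_F.
move=> x _; rewrite /fubini_F patchE; case: ifPn => [xI|_]; last first.
  by apply: integral_ge0.
apply: le_trans (gf x _) _; first by rewrite inE in xI.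
rewrite [leLHS]integral_mkcond le_eqVlt; apply/orP; left; apply/eqP.
apply: eq_integral => y _; rewrite !patchE in_setX xI /=.
by [].
Qed.

Lemma measurable_mode (r : R) (cs : R -> R) m n s : continuous cs ->
  measurable_fun [set: T2] (mode r cs m n s).
Proof.
move=> ccs; rewrite /mode; case: phase_triple => -[L M] N.
pose F (k1 d1 h1 k2 d2 h2 k3 d3 h3 : R) (z : T2) : R :=
  cos (k1 * (3 * r - z.2) - d1) * cs (h1 * (z.1 - Num.sqrt 3 * r)) +
  cos (k2 * (3 * r - z.2) - d2) * cs (h2 * (z.1 - Num.sqrt 3 * r)) +
  cos (k3 * (3 * r - z.2) - d3) * cs (h3 * (z.1 - Num.sqrt 3 * r)).
have mcos (k d A : R) : measurable_fun [set: T2]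
    (fun z : T2 => cos (k * (A - z.2) - d)).
  apply: measurableT_comp.
    by apply: continuous_measurable_fun; exact: continuous_cos.
  apply: measurable_funB => //; apply: measurable_funM => //.
  by apply: measurable_funB => //; exact: measurable_snd.
have mcs (k A : R) : measurable_fun [set: T2]
    (fun z : T2 => cs (k * (z.1 - A))).
  apply: measurableT_comp; first by apply: continuous_measurable_fun.
  apply: measurable_funM => //.
  by apply: measurable_funB => //; exact: measurable_fst.
have mF k1 d1 h1 k2 d2 h2 k3 d3 h3 :
    measurable_fun setT (F k1 d1 h1 k2 d2 h2 k3 d3 h3).
  apply: measurable_funD; [apply: measurable_funD|]; apply: measurable_funM;
  [exact: mcos|exact: mcs|exact: mcos|exact: mcs|exact: mcos|exact: mcs].
apply: (eq_measurable_fun _ _ (mF _ _ _ _ _ _ _ _ _)) => -[x y] _.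
by rewrite /F; reflexivity.
Qed.

Lemma measurable_modal (r : R) m n s a b :
  measurable_fun [set: T2]
    (fun z => a * mode_s r m n s z + b * mode_a r m n s z).
Proof.
apply: measurable_funD; apply: measurable_funM => //; apply: measurable_mode.
- exact: continuous_cos.
- exact: continuous_sin.
Qed.

Section neumann.
Variable r : R.
Hypothesis r0 : 0 < r.

(** In units of [3 * r / 36], the product [q * x] lies between 35 and 37 while [y] lies between 1
    and 34; hence [y < q * x], and [y + q * x] is at most 71, below the 72 units of [6 * r]. *)
Lemma rect_sub_triangle (q x y : R) : 0 < q -> q * q = 3 ->
  q * r - q * r / 36 <= x -> x <= q * r + q * r / 36 ->
  3 * r / 36 <= y -> y <= 3 * r - 3 * r / 18 ->
  [/\ 0 < y, y < q * x & y + q * x < 6 * r].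
Proof.
move=> q0 q2 x1 x2 y1 y2.
have h1 : 35 / 36 * (3 * r) <= q * x.
  have <- : q * (q * r - q * r / 36) = 35 / 36 * (3 * r) by rewrite -q2; field.
  by rewrite ler_pM2l.
have h2 : q * x <= 37 / 36 * (3 * r).
  have <- : q * (q * r + q * r / 36) = 37 / 36 * (3 * r) by rewrite -q2; field.
  by rewrite ler_pM2l.
by have := r0; split; lra.
Qed.

Let A : R := 3 * r.
Let A0 : 0 < A. Proof. by rewrite mulr_gt0. Qed.

Let J : set (measurableTypeR R) := `[(A / 36)%R, (A - A / 18)%R]%classic.
Let w : R := Num.sqrt 3 * r / 36.
Let I : set (measurableTypeR R) :=
  `[(Num.sqrt 3 * r - w)%R, (Num.sqrt 3 * r + w)%R]%classic.

Let c a b (q x : R) : R :=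
  a * cos (Num.sqrt 3 * pi / (9 * r) * q * (x - Num.sqrt 3 * r)) +
  b * sin (Num.sqrt 3 * pi / (9 * r) * q * (x - Num.sqrt 3 * r)).

Let v m n a b (z : R * R) : R := a * mode_s r m n 0 z + b * mode_a r m n 0 z.

Let k (p : nat) : R := p%:R * pi / A.

Let vE m n a b x y : v m n a b (x, y) =
  c a b (m%:R - n%:R) x * cos (k (m + n) * (A - y)) +
  c a b (m%:R + 2 * n%:R) x * cos (k m * (A - y)) +
  c a b (- (2 * m%:R + n%:R)) x * cos (k n * (A - y)).
Proof. exact: neumann_modeE. Qed.

Let rect_sub : I `*` J `<=` triT r.
Proof.
move=> [x y] []; rewrite /I /J /= !in_itv /= => /andP[x1 x2] /andP[y1 y2].
by rewrite triTE//=; apply: rect_sub_triangle => //; exact: sqrt3_sqr.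
Qed.

Let slice_offdiag m n a b x : (m < n)%N ->
  ((A / 4 * c a b (m%:R + 2 * n%:R) x ^+ 2)%:E <=
   \int[lebesgue_measure]_(y in J) (v m n a b (x, y) ^+ 2)%:E)%E.
Proof.
move=> mn; under eq_integral do rewrite vE.
set c1 := c a b (m%:R - n%:R) x; set c2 := c a b (m%:R + 2 * n%:R) x.
set c3 := c a b (- (2 * m%:R + n%:R)) x.
have A4 : 0 <= A / 4 by rewrite divr_ge0// ltW.
(* For [m = 0] the frequencies [m + n] and [n] coincide and their coefficients merge, but the
   coefficient [c2] of frequency [m] stays alone. The index [2 * n] only fills the third slot, with
   coefficient 0. *)
have [m0|m0] := eqVneq m 0%N.
  have := @cos3_square_lower _ A (c1 + c3) c2 0 n 0 (2 * n)%N k A0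
    ltac:(lia) ltac:(lia) ltac:(lia) (fun=> erefl).
  move=> h; apply: (le_trans (le_trans _ h)).
    rewrite lee_fin ler_wpM2l// expr0n /= addr0 lerDr.
    exact: sqr_ge0.
  rewrite le_eqVlt; apply/orP; left; apply/eqP; apply: eq_integral => y _.
  by rewrite m0 add0n; congr ((_ ^+ 2)%:E); ring.
have := @cos3_square_lower _ A c1 c2 c3 (m + n) m n k A0
    ltac:(lia) ltac:(lia) ltac:(lia) (fun=> erefl).
apply: le_trans; rewrite lee_fin ler_wpM2l//.
by have := sqr_ge0 c1; have := sqr_ge0 c3; lra.
Qed.

Let slice_diag m a x :
  ((A / 4 * a ^+ 2)%:E <=
   \int[lebesgue_measure]_(y in J) (v m m a 0 (x, y) ^+ 2)%:E)%E.
Proof.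
under eq_integral do rewrite vE.
have -> : c a 0 (m%:R - m%:R) x = a.
  by rewrite /c subrr mulr0 mul0r cos0 mulr1 mul0r addr0.
have A4 : 0 <= A / 4 by rewrite divr_ge0// ltW.
(* For [m = 0] all three frequencies are 0 and the mode is the constant [3 * a]. Otherwise the two
   terms of frequency [m] merge, apart from the term [a] of frequency [2 * m]. *)
have [m0|m0] := eqVneq m 0%N.
  have := @cos3_square_lower _ A (3 * a) 0 0 0 1 2 k A0 erefl erefl erefl
    (fun=> erefl).
  move=> h; apply: (le_trans (le_trans _ h)).
    rewrite lee_fin ler_wpM2l// expr0n /= !addr0.
    by have := sqr_ge0 a; rewrite !expr2; lra.
  rewrite le_eqVlt; apply/orP; left; apply/eqP; apply: eq_integral => y _.
  rewrite m0 /c /k !(mulr0, mul0r, addr0, add0n, oppr0, cos0, mulr1).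
  by congr ((_ ^+ 2)%:E); ring.
set c2 := c a 0 _ x; set c3 := c a 0 _ x.
have := @cos3_square_lower _ A a (c2 + c3) 0 (m + m) m 0 k A0
    ltac:(lia) ltac:(lia) ltac:(lia) (fun=> erefl).
move=> h; apply: (le_trans (le_trans _ h)).
  rewrite lee_fin ler_wpM2l// expr0n /= addr0 lerDl.
  exact: sqr_ge0.
rewrite le_eqVlt; apply/orP; left; apply/eqP; apply: eq_integral => y _.
by congr ((_ ^+ 2)%:E); ring.
Qed.

Lemma neumann_norm_lower : exists2 K : R, 0 < K &
  forall m n a b, (m < n)%N \/ (m = n /\ b = 0) ->
  ((K * (a ^+ 2 + b ^+ 2))%:E <=
   \int[leb2]_(z in triT r) ((a * mode_s r m n 0 z + b * mode_a r m n 0 z) ^+ 2)%:E)%E.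
Proof.
have q0 := @sqrt3_gt0 R; have p0 := pi_gt0 R.
have w0 : 0 < w by rewrite !mulr_gt0.
have kk0 : 0 < Num.sqrt 3 * pi / (9 * r) by rewrite divr_gt0 ?mulr_gt0.
(* The horizontal wave number attached to [p = m] is this [k0] times [m + 2 * n], a factor at least
   1 when [m < n]. *)
have [K1 K10 HK1] := cos_sin_square_lower kk0 w0.
have A4 : 0 < A / 4 by rewrite divr_gt0.
have A4w : 0 < A / 4 * (2 * w) by rewrite mulr_gt0// mulr_gt0.
(* The first entry serves [m < n]; the second serves [m = n], with [2 * w] the length of [I]. *)
exists (Num.min (A / 4 * K1) (A / 4 * (2 * w))).
  by rewrite lt_min A4w mulr_gt0.
have mI : measurable I by exact: measurable_itv.
have mJ : measurable J by exact: measurable_itv.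
have mT := measurable_triT r0.
have mv m n a b : measurable_fun setT (fun z : T2 => v m n a b z ^+ 2).
  by apply: measurable_funX; exact: measurable_modal.
move=> m n a b mn; rewrite -/(v m n a b _).
have ab0 : 0 <= a ^+ 2 + b ^+ 2 by rewrite addr_ge0 ?sqr_ge0.
case: mn => [mn|[<- ->]].
  pose cc (x : measurableTypeR R) := c a b (m%:R + 2 * n%:R) x ^+ 2.
  have mcc : measurable_fun setT cc.
    apply: continuous_measurable_fun => x.
    by apply/differentiable_continuous/derivable1_diffP; rewrite /cc /c.
  apply: (@le_trans _ _ (\int[lebesgue_measure]_(x in I) (A / 4 * cc x)%:E)%E).
    under eq_integral do rewrite EFinM.
    rewrite ge0_integralZl//; last 3 first.
    - by apply/measurable_EFinP; exact: measurable_funTS.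
    - by move=> x _; rewrite lee_fin sqr_ge0.
    - by rewrite lee_fin ltW.
    apply: (@le_trans _ _ ((A / 4)%:E * (K1 * (a ^+ 2 + b ^+ 2))%:E)%E).
      by rewrite -EFinM lee_fin [leRHS]mulrA ler_wpM2r// ge_min lexx.
    rewrite lee_pmul2l ?lte_fin//; apply: HK1.
    rewrite ler_peMr ?ltW//.
    have : 1 <= n%:R :> R by rewrite ler1n; lia.
    by have : 0 <= m%:R :> R by []; lra.
  apply: (le_integral_rect mI mJ mT rect_sub) => //.
  - exact: mv.
  - exact: measurable_funM.
  - by move=> z; exact: sqr_ge0.
  - by move=> x; rewrite mulr_ge0 ?sqr_ge0// ltW.
  - by move=> x _; exact: slice_offdiag.
apply: (@le_trans _ _ (\int[lebesgue_measure]_(x in I) (A / 4 * a ^+ 2)%:E)%E).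
  have lI : (lebesgue_measure I = (2 * w)%:E)%E.
    have h := @lebesgue_measure_itv R
      `[(Num.sqrt 3 * r - w)%R, (Num.sqrt 3 * r + w)%R].
    rewrite [LHS]h /= lte_fin ifT; last by lra.
    by rewrite -EFinB; congr (_%:E); ring.
  rewrite integral_cst// [X in (_ * X)%E]lI -EFinM lee_fin expr0n /= addr0.
  apply: (@le_trans _ _ (A / 4 * (2 * w) * a ^+ 2)).
    by rewrite ler_wpM2r ?sqr_ge0// ge_min lexx orbT.
  by rewrite le_eqVlt; apply/orP; left; apply/eqP; ring.
apply: (le_integral_rect mI mJ mT rect_sub) => //.
- exact: mv.
- by move=> z; exact: sqr_ge0.
- by move=> x; rewrite mulr_ge0 ?sqr_ge0// ltW.
- by move=> x _; exact: slice_diag.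
Qed.

End neumann.
End lower_bound.

(** * From pointwise distances to the gap between modal spaces *)

Section gap_bound.
Set Implicit Arguments.
Unset Strict Implicit.
Unset Printing Implicit Defensive.
Context {R : realType}.
Notation T2 := (measurableTypeR R * measurableTypeR R)%type.
Implicit Types (a b s : R).

Lemma measurable_sqr_EFin (D : set T2) (f : T2 -> R) :
  measurable_fun setT f -> measurable_fun D (fun z => (f z ^+ 2)%:E).
Proof.
move=> mf; apply/measurable_EFinP; apply: measurable_funTS.
exact: measurable_funX.
Qed.

Lemma l2norm_eq1 (D : set (R * R)) u :
  l2norm D u = 1%E -> (\int[leb2]_(z in D) (u z ^+ 2)%:E = 1)%E.
Proof.
rewrite l2normE; set x := integral _ _ _ => h.
have x0 : (0 <= x)%E by apply: integral_ge0 => z _; rewrite lee_fin sqr_ge0.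
have := congr1 (fun y => (y `^ 2)%E) h.
by rewrite -poweRrM mulVf// poweRe1// poweR1r.
Qed.

Lemma l2norm_le (D : set (R * R)) u (M : R) : 0 <= M ->
  (\int[leb2]_(z in D) (u z ^+ 2)%:E <= M%:E)%E ->
  (l2norm D u <= (Num.sqrt M)%:E)%E.
Proof.
move=> M0; rewrite l2normE; set x := integral _ _ _ => xM.
have x0 : (0 <= x)%E by apply: integral_ge0 => z _; rewrite lee_fin sqr_ge0.
rewrite -powR12_sqrt// -poweR_EFin; apply: gt0_ler_poweR => //.
- by rewrite in_itv /= x0 leey.
- by rewrite in_itv /= leey lee_fin M0.
Qed.

Section triangle.
Variables (r : R) (r0 : 0 < r).

(** The area of the box given by [triT_bounds], which is twice as high as the triangle. *)
Let V : R := (2 * (Num.sqrt 3 * r)) * (6 * r).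

Lemma area_triT_le : (leb2 (triT r) <= V%:E)%E.
Proof.
have q0 := @sqrt3_gt0 R.
have qr0 : 0 < Num.sqrt 3 * r by rewrite mulr_gt0.
pose I : set (measurableTypeR R) := `[0%R, (2 * (Num.sqrt 3 * r))%R]%classic.
pose J : set (measurableTypeR R) := `[0%R, (6 * r)%R]%classic.
have mI : measurable I by exact: measurable_itv.
have mJ : measurable J by exact: measurable_itv.
have len (t : R) : 0 < t -> (lebesgue_measure (`[0%R, t]%classic : set R) = t%:E)%E.
  by move=> t0; rewrite lebesgue_measure_itv /= lte_fin t0 oppr0 adde0.
have -> : V%:E = leb2 (I `*` J).
  have E : (leb2 (I `*` J) = lebesgue_measure I * lebesgue_measure J)%E.
    exact: product_measure1E.
  rewrite E [X in (X * _)%E](len (2 * (Num.sqrt 3 * r))) ?mulr_gt0//.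
  by rewrite [X in (_ * X)%E](len (6 * r)) ?mulr_gt0.
apply: le_measure; rewrite ?inE.
- exact: measurable_triT.
- exact: measurableX.
move=> [x y] /(triT_bounds r0)[]; rewrite !ler_norml => /andP[y1 y2] /andP[x1 x2].
have hx : 0 <= x <= 2 * (Num.sqrt 3 * r) by apply/andP; split; lra.
have hy : 0 <= y <= 6 * r by apply/andP; split; lra.
by split; rewrite /I /J /= in_itv /=.
Qed.

Lemma integral_sqr_triT_le (f : T2 -> R) (M : R) : 0 <= M ->
  measurable_fun setT f ->
  (forall z, triT r z -> f z ^+ 2 <= M) ->
  (\int[leb2]_(z in triT r) (f z ^+ 2)%:E <= (M * V)%:E)%E.
Proof.
move=> M0 mf fM; have mT := measurable_triT r0.
apply: (@le_trans _ _ (\int[leb2]_(z in triT r) (cst M%:E z))%E).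
  apply: ge0_le_integral => //.
  - by move=> z _; rewrite lee_fin sqr_ge0.
  - exact: measurable_sqr_EFin.
rewrite integral_cst// EFinM lee_wpmul2l ?lee_fin//.
exact: area_triT_le.
Qed.

(** Integrates [g ^ 2 <= 2 * f ^ 2 + 2 * (f - g) ^ 2], which is [(2 * f - g) ^ 2 >= 0]. It passes
    from the norm of a Robin mode to that of its Neumann limit. *)
Lemma integral_sqr_le_double (f g : T2 -> R) (W : R) :
  measurable_fun setT f -> measurable_fun setT g ->
  (\int[leb2]_(z in triT r) ((f z - g z) ^+ 2)%:E <= W%:E)%E ->
  (\int[leb2]_(z in triT r) (g z ^+ 2)%:E <=
   2%:E * \int[leb2]_(z in triT r) (f z ^+ 2)%:E + (2 * W)%:E)%E.
Proof.
move=> mf mg hW; have mT := measurable_triT r0.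
have mfg : measurable_fun setT (fun z => f z - g z) by exact: measurable_funB.
have sq0 (h : T2 -> R) z : triT r z -> (0 <= (h z ^+ 2)%:E)%E.
  by move=> _; rewrite lee_fin sqr_ge0.
have m2 (h : T2 -> R) : measurable_fun setT h ->
    measurable_fun (triT r) (fun z => (2%:E * (h z ^+ 2)%:E)%E).
  move=> mh; have := @measurable_sqr_EFin (triT r) h mh.
  exact: measurable_funeM.
apply: (@le_trans _ _ (\int[leb2]_(z in triT r)
    (2%:E * (f z ^+ 2)%:E + 2%:E * ((f z - g z) ^+ 2)%:E))%E).
  apply: ge0_le_integral => //.
  - exact: sq0.
  - exact: measurable_sqr_EFin.
  - by apply: emeasurable_funD; exact: m2.
  - move=> z _; rewrite -!EFinM -EFinD lee_fin.
    have := sqr_ge0 (2 * f z - g z); rewrite !expr2; lra.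
rewrite ge0_integralD//; last 4 first.
- by move=> z Tz; rewrite mule_ge0 ?lee_fin ?sqr_ge0.
- exact: m2.
- by move=> z Tz; rewrite mule_ge0 ?lee_fin ?sqr_ge0.
- exact: m2.
rewrite !ge0_integralZl//; try exact: measurable_sqr_EFin; try exact: sq0.
by rewrite EFinM leeD2l// lee_pmul2l.
Qed.

Let mod m n s a b (z : T2) : R := a * mode_s r m n s z + b * mode_a r m n s z.

(* [1458 = 2 * 27 ^ 2], with the [27] of [mode_dist]. *)
Lemma modal_dist m n s a b : 0 <= s ->
  (\int[leb2]_(z in triT r) ((mod m n s a b z - mod m n 0 a b z) ^+ 2)%:E <=
   (1458 * V * (3 * r * s) * (a ^+ 2 + b ^+ 2))%:E)%E.
Proof.
move=> s0; have c0 : 0 <= 3 * r * s by rewrite !mulr_ge0// ltW.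
have -> : 1458 * V * (3 * r * s) * (a ^+ 2 + b ^+ 2) =
  (1458 * (3 * r * s) * (a ^+ 2 + b ^+ 2)) * V by ring.
apply: (@integral_sqr_triT_le (fun z => mod m n s a b z - mod m n 0 a b z)).
  - apply: mulr_ge0; last by rewrite addr_ge0 ?sqr_ge0.
    by apply: mulr_ge0; first exact: ler0n.
  - by apply: measurable_funB; exact: measurable_modal.
move=> z Tz; set e := Num.sqrt (3 * r * s).
have e2 : e ^+ 2 = 3 * r * s by rewrite sqr_sqrtr.
have h1 := mode_dist r0 m n cos_lipschitz (@cos_max R) s0 Tz.
have h2 := mode_dist r0 m n sin_lipschitz (@sin_max R) s0 Tz.
rewrite -e2 /mod /mode_s /mode_a; move: h1 h2; rewrite -/e.
set u1 := mode _ cos _ _ s z; set u2 := mode _ cos _ _ 0 z.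
set v1 := mode _ sin _ _ s z; set v2 := mode _ sin _ _ 0 z => h1 h2.
have -> : a * u1 + b * v1 - (a * u2 + b * v2) = a * (u1 - u2) + b * (v1 - v2).
  by ring.
have sq (t : R) : `|t| <= 27 * e -> t ^+ 2 <= 729 * e ^+ 2.
  move=> te; rewrite -real_normK ?num_real//.
  have -> : 729 * e ^+ 2 = (27 * e) ^+ 2 by ring.
  by rewrite ler_pXn2r// nnegrE (le_trans _ te).
have k1 := sq _ h1; have k2 := sq _ h2.
apply: (@le_trans _ _ (2 * (a ^+ 2 * (u1 - u2) ^+ 2 + b ^+ 2 * (v1 - v2) ^+ 2))).
  have := sqr_ge0 (a * (u1 - u2) - b * (v1 - v2)).
  by rewrite -!exprMn !expr2; lra.
have l1 : a ^+ 2 * (u1 - u2) ^+ 2 <= a ^+ 2 * (729 * e ^+ 2).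
  by rewrite ler_wpM2l// sqr_ge0.
have l2 : b ^+ 2 * (v1 - v2) ^+ 2 <= b ^+ 2 * (729 * e ^+ 2).
  by rewrite ler_wpM2l// sqr_ge0.
have -> : 1458 * e ^+ 2 * (a ^+ 2 + b ^+ 2) =
  2 * (a ^+ 2 * (729 * e ^+ 2) + b ^+ 2 * (729 * e ^+ 2)) by ring.
lra.
Qed.

(** On the diagonal the antisymmetric mode vanishes, so its coefficient may be reset to 0, as
    [neumann_norm_lower] requires. *)
Lemma modal_spaceP m n s u : (m <= n)%N -> 0 <= s -> modal_space r m n s u ->
  exists a b, [/\ (m < n)%N \/ (m = n /\ b = 0) & u = mod m n s a b].
Proof.
move=> mn s0 [a [b ->]]; move: mn; rewrite leq_eqVlt => /orP[/eqP <-|mn].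
  exists a, 0; split; first by right.
  by apply/funext => z; rewrite /mod mode_a_diag// !mulr0.
by exists a, b; split => //; left.
Qed.

(** A unit vector of one space is compared with the combination having the same coefficients in the
    other. By [modal_dist] the squared distance is at most a multiple of [s * (a ^ 2 + b ^ 2)], so
    the coefficients must be bounded by the norm. *)
Lemma modal_gap_le : exists2 C : R, 0 < C & forall m n s, (m <= n)%N ->
  0 <= s -> C * s <= 1 ->
  (gap (triT r) (modal_space r m n s) (neumann_space r m n) <=
   (Num.sqrt (C * s))%:E)%E.
Proof.
have [K K0 HK] := neumann_norm_lower r0.
have q0 := @sqrt3_gt0 R.
have V0 : 0 < V by rewrite !mulr_gt0.
(* Chosen so that [C * s * K = 4 * W]: then [K * S <= 4] gives [W * S <= C * s], and [C * s <= 1]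
   gives [4 * W <= K]. *)
pose C := 4 * 1458 * V * (3 * r) / K.
have C0 : 0 < C by rewrite divr_gt0 ?mulr_gt0 ?ltr0n.
exists C => // m n s mn s0 Cs.
have Cs0 : 0 <= C * s by rewrite mulr_ge0// ltW.
pose W := 1458 * V * (3 * r * s).
have CK : C * s * K = 4 * W.
  by rewrite /C /W; field; rewrite gt_eqF.
have W4 : 4 * W <= K by rewrite -CK; have := K0; nra.
have mm s' a b : measurable_fun setT (mod m n s' a b) by exact: measurable_modal.
have small S : K * S <= 4 -> W * S <= C * s.
  move=> KS; rewrite -(@ler_pM2r _ 4)//.
  have -> : W * S * 4 = C * s * (K * S) by rewrite mulrA CK; ring.
  by rewrite ler_wpM2l.
have S0 a b : 0 <= a ^+ 2 + b ^+ 2 by rewrite addr_ge0 ?sqr_ge0.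
have symdist a b : (\int[leb2]_(z in triT r)
    ((mod m n 0 a b z - mod m n s a b z) ^+ 2)%:E =
   \int[leb2]_(z in triT r) ((mod m n s a b z - mod m n 0 a b z) ^+ 2)%:E)%E.
  by apply: eq_integral => z _; congr (_%:E); ring.
rewrite /gap ge_max; apply/andP; split; apply: ge_ereal_sup => _ [u [Eu u1] <-].
  have [a [b [ab uE]]] := modal_spaceP mn s0 Eu.
  have {}u1 := l2norm_eq1 u1.
  apply: (@le_trans _ _ (l2norm (triT r) (u \- mod m n 0 a b))).
    by apply: ereal_inf_lbound; exists (mod m n 0 a b) => //; exists a, b.
  apply: l2norm_le => //; have hd := modal_dist m n a b s0.
  rewrite uE; apply: le_trans hd _; rewrite lee_fin; apply: small.
  (* The lower bound concerns Neumann modes while [u] is a Robin mode. With [S = a ^ 2 + b ^ 2] this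
     gives [K * S <= 2 + 2 * W * S]; the last term is at most [K * S / 2] and is absorbed, so
     [K * S <= 4]. *)
  have := integral_sqr_le_double (mm s a b) (mm 0 a b) (modal_dist m n a b s0).
  move=> /(le_trans (HK _ _ _ _ ab)).
  rewrite -uE u1 mule1 -EFinD lee_fin -/W => h.
  have := S0 a b; move: h; move: (_ + _) => S h S00.
  by have := ler_wpM2r S00 W4; lra.
have [a [b [ab uE]]] := modal_spaceP mn (lexx 0) Eu.
have {}u1 := l2norm_eq1 u1.
apply: (@le_trans _ _ (l2norm (triT r) (u \- mod m n s a b))).
  by apply: ereal_inf_lbound; exists (mod m n s a b) => //; exists a, b.
apply: l2norm_le => //; have hd := modal_dist m n a b s0.
rewrite uE symdist; apply: le_trans hd _; rewrite lee_fin; apply: small.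
(* Here [u] is itself a Neumann mode and the lower bound applies directly. *)
have : ((K * (a ^+ 2 + b ^+ 2))%:E <= 1)%E by rewrite -u1 uE; exact: HK.
by rewrite lee_fin; lra.
Qed.

End triangle.
End gap_bound.

Theorem lemma5p18 (R : realType) (r : R) (r_gt0 : 0 < r) :
  exists (sigma0 : R) (eps : R -> R),
    [/\ 0 < sigma0,
        forall s : R, 0 <= s <= sigma0 -> 0 <= eps s,
        eps s @[s --> 0^'+] --> 0 &
        forall s : R, 0 <= s <= sigma0 ->
          (ereal_sup [set gap (triT r) (modal_space r mn.1 mn.2 s)
                                     (neumann_space r mn.1 mn.2)
                     | mn in [set mn : nat * nat | (mn.1 <= mn.2)%N]]
           <= (eps s)%:E)%E].
Proof.
have [C C0 HC] := modal_gap_le r_gt0.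
(* The threshold [C^-1] is the condition [C * s <= 1] of [modal_gap_le]. *)
exists C^-1, (fun s => Num.sqrt (C * s)); split.
- by rewrite invr_gt0.
- by move=> s _; exact: sqrtr_ge0.
- have : Num.sqrt (C * s) @[s --> 0^'+] --> Num.sqrt (C * 0).
    apply: cvg_at_right_filter; apply: continuous_cvg.
      exact: sqrt_continuous.
    by apply: cvgM; [exact: cvg_cst|exact: cvg_id].
  by rewrite mulr0 sqrtr0.
- move=> s /andP[s0 s1]; apply: ge_ereal_sup => _ [[m n] /= mn <-].
  by apply: HC => //; rewrite mulrC -ler_pdivlMr// mul1r.
Qed.
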